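(* Let $X$ be an Archimedean pre-Riesz space with the Riesz decomposition property. Then every directed band in $X$ is s-closed.
   Context: An ordered vector space is a real vector space $X$ with the partial order given by a cone $X_+$ ($x\le y$ iff $y-x\in X_+$); it is Archimedean if $nx\le y$ for all $n\in\mathbb{N}$ implies $x\le 0$. Put $[a,b]:=\{x\in X: a\le x\le b\}$. A subset $A\subseteq X$ is directed if for all $x,y\in A$ there are $z_1,z_2\in A$ with $z_1\le x,y\le z_2$. $X$ has the Riesz decomposition property (RDP) if for all $x_1,x_2,z\in X_+$ with $z\le x_1+x_2$ there are $z_1,z_2\in X_+$ with $z=z_1+z_2$, $z_1\le x_1$, $z_2\le x_2$. A linear subspace $X_0$ of an ordered vector space $Y$ is order dense in $Y$ if $y=\inf\{z\in X_0: y\le z\}$ for every $y\in Y$. $X$ is a pre-Riesz space if there are a vector lattice $Y$ and a bipositive linear map $i:X\to Y$ (i.e. $x\ge0 \Leftrightarrow i(x)\ge 0$) with $i(X)$ order dense in $Y$. For $M\subseteq X$ let $M^u$ be the set of all upper bounds of $M$ in $X$. Elements $x,y\in X$ are disjoint, $x\perp y$, if $\{x+y,-x-y\}^u=\{x-y,-x+y\}^u$. The disjoint complement of $A\subseteq X$ is $A^{d}:=\{x\in X: x\perp a \text{ for all } a\in A\}$ and $A^{dd}:=(A^d)^d$. A linear subspace $B$ is a band if $B^{dd}=B$. A set $M\subseteq X$ is solid if for all $x\in X$, $y\in M$, $\{x,-x\}^u\supseteq\{y,-y\}^u$ implies $x\in M$; an ideal is a solid linear subspace. Every band in a pre-Riesz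 space is an ideal. An ideal $I$ is s-closed (supremum closed) if for every $z\in X_+$ the relation $z=\sup(I\cap[0,z])$ (meaning that the supremum exists in $X$ and equals $z$) implies $z\in I$. *)

(* Defs.v *)
From HB Require Import structures.
From mathcomp Require Import all_boot all_order all_algebra.
From mathcomp Require Import boolp classical_sets set_interval reals.

Set Implicit Arguments.
Unset Strict Implicit.
Unset Printing Implicit Defensive.

Import Order.TTheory GRing.Theory Num.Theory.
Local Open Scope classical_set_scope.
Local Open Scope ring_scope.

(* The cone is [set x : X | 0 <= x]; that it meets its opposite only in 0 is
   the antisymmetry of the order. *)
HB.mixin Record isOrderedVector (R : realType) X
    of GRing.Lmodule R X & Num.POrderedZmodule X := {
  subv_ge0 : forall x y : X, (0 <= y - x) = (x <= y);
  addv_ge0 : forall x y : X, 0 <= x -> 0 <= y -> 0 <= x + y;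
  scalev_ge0 : forall (a : R) (x : X), 0 <= a -> 0 <= x -> 0 <= a *: x
}.

#[short(type="orderedVectType")]
HB.structure Definition OrderedVector (R : realType) :=
  { X of GRing.Lmodule R X & Num.POrderedZmodule X & isOrderedVector R X }.

Section OrderedVectorSpace.
Context {R : realType}.
Implicit Types X Y : orderedVectType R.

Definition archimedean X : Prop :=
  forall x y : X, (forall n : nat, x *+ n <= y) -> x <= 0.

Definition directed X (A : set X) : Prop :=
  forall x y, A x -> A y ->
  exists z1 z2, [/\ A z1, A z2, z1 <= x <= z2 & z1 <= y <= z2].

Definition riesz_decomposition X : Prop :=
  forall x1 x2 z : X, 0 <= x1 -> 0 <= x2 -> 0 <= z -> z <= x1 + x2 ->
  exists z1 z2 : X,
    [/\ 0 <= z1, 0 <= z2, z = z1 + z2, z1 <= x1 & z2 <= x2].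

Definition linear_subspace X (B : set X) : Prop := submod_closed [in B].

Definition order_dense X (D : set X) : Prop :=
  linear_subspace D /\ forall y, infimums [set z | D z /\ y <= z] y.

Definition bipositive X Y (i : X -> Y) : Prop :=
  forall x, 0 <= x <-> 0 <= i x.

Definition vector_lattice X : Prop :=
  forall x y : X,
    supremums [set x; y] !=set0 /\ infimums [set x; y] !=set0.

Definition pre_riesz X : Prop :=
  exists (Y : orderedVectType R) (i : {linear X -> Y}),
    [/\ vector_lattice Y, bipositive i & order_dense (range i)].

Definition disjointv X (x y : X) : Prop :=
  ubound [set x + y; - x - y] = ubound [set x - y; - x + y].

Definition dcompl X (A : set X) : set X :=
  [set x | forall a, A a -> disjointv x a].

Definition band X (B : set X) : Prop :=
  linear_subspace B /\ dcompl (dcompl B) = B.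

Definition solid X (M : set X) : Prop :=
  forall x y, M y -> ubound [set y; - y] `<=` ubound [set x; - x] -> M x.

Definition ideal X (I : set X) : Prop := solid I /\ linear_subspace I.

(* [supremums A z] says that the supremum of A exists and equals z. *)
Definition s_closed X (I : set X) : Prop :=
  ideal I /\
  forall z, 0 <= z -> supremums (I `&` `[0, z]%classic) z -> I z.

End OrderedVectorSpace.

Arguments archimedean {R} X.
Arguments vector_lattice {R} X.
Arguments riesz_decomposition {R} X.
Arguments pre_riesz {R} X.

(* Main.v *)
Require Import Defs.
From mathcomp Require Import all_boot all_order all_algebra.
From mathcomp Require Import boolp classical_sets set_interval reals.

(* If z = sup S with S nonempty and every s in S disjoint from a, then z is
   disjoint from a: an upper bound v of z + a and - z - a yields the upper bound
   v + (z - s) of s + a and - s - a, hence of s - a and - s + a, so that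
   2 s <= v + z + a for all s in S, and therefore z - a <= v.  Applied to
   S = B `&` [0, z] and to a in the disjoint complement of B, this gives z in
   B^dd = B.  Solidity of the band is checked in the vector lattice cover,
   where disjointness means that the positive and negative parts of the two
   elements have infimum 0. *)

Set Implicit Arguments.
Unset Strict Implicit.
Unset Printing Implicit Defensive.

Import Order.TTheory GRing.Theory Num.Theory.
Local Open Scope classical_set_scope.
Local Open Scope ring_scope.

Section OrderedVectorTheory.
Context {R : realType} {X : orderedVectType R}.
Implicit Types (x y z t u v w a b c p q r s : X) (A S : set X).

(** * Order arithmetic in ordered vector spaces *)

Lemma lev_D2r z x y : (x + z <= y + z) = (x <= y).
Proof. 
by rewrite -(@subv_ge0 R _ (x + z)) -(@subv_ge0 R _ x) opprD addrACA subrr addr0.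
Qed.

Lemma lev_D2l z x y : (z + x <= z + y) = (x <= y).
Proof. by rewrite ![z + _]addrC lev_D2r. Qed.

Lemma lev_D x y z t : x <= y -> z <= t -> x + z <= y + t.
Proof.
move=> xy zt; apply: (@le_trans _ _ (y + z)); first by rewrite lev_D2r.
by rewrite ![y + _]addrC lev_D2r.
Qed.

Lemma lev_subl x y z : (x - y <= z) = (x <= z + y).
Proof. by rewrite -[LHS](lev_D2r y) subrK. Qed.

Lemma lev_subr x y z : (x <= y - z) = (x + z <= y).
Proof. by rewrite -[LHS](lev_D2r z) subrK. Qed.

Lemma lev_N2 x y : (- x <= - y) = (y <= x).
Proof.
by rewrite -(@subv_ge0 R _ (- x)) -(@subv_ge0 R _ y) opprK addrC.
Qed.

Lemma half_ex x : exists h, h + h = x.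
Proof.
exists (2^-1 *: x).
by rewrite -scalerDr -mulr2n -scaler_nat scalerA mulVf ?scale1r// pnatr_eq0.
Qed.

Lemma lev_double x y : (x + x <= y + y) = (x <= y).
Proof.
apply/idP/idP=> [xy|xy]; last exact: lev_D.
have half v : v = 2^-1 *: (v + v).
  by rewrite -mulr2n -scaler_nat scalerA mulVf ?scale1r// pnatr_eq0.
rewrite [x]half [y]half.
rewrite -(@subv_ge0 R) -scalerBr scalev_ge0 ?invr_ge0 ?ler0n//.
by rewrite subv_ge0.
Qed.

(** * Disjointness and its stability under suprema *)

Lemma ubound2E x y u : ubound [set x; y] u <-> x <= u /\ y <= u.
Proof.
split=> [h|[hx hy] _ [->|->]//]; by split; apply: h; [left|right].
Qed.

Lemma disjointvP x a : disjointv x a <->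
  (forall u, x + a <= u /\ - x - a <= u <-> x - a <= u /\ - x + a <= u).
Proof.
split=> [h u|h]; first by rewrite -!ubound2E h.
by apply/seteqP; split=> u /ubound2E /h /ubound2E.
Qed.

Lemma disjointvNr x a : disjointv x a -> disjointv x (- a).
Proof. by rewrite /disjointv !opprK => ->. Qed.

Lemma disjointvNl x a : disjointv x a -> disjointv (- x) a.
Proof.
move=> xa; rewrite /disjointv opprK.
by rewrite [X in ubound X]setUC -xa [in LHS]setUC.
Qed.

Lemma disjointvI x a :
  (forall u, x + a <= u -> - x - a <= u -> x - a <= u /\ - x + a <= u) ->
  (forall u, x - a <= u -> - x + a <= u -> x + a <= u /\ - x - a <= u) ->
  disjointv x a.
Proof. by move=> h1 h2; apply/disjointvP => u; split=> -[]; auto. Qed.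

Lemma disjointv_sup S z a : S !=set0 -> supremums S z ->
  (forall s, S s -> disjointv s a) -> disjointv z a.
Proof.
move=> S0 [zub zlb].
(* Stated for every [b], because the converse inclusion is the case [b = - a]. *)
suff main b : (forall s, S s -> disjointv s b) ->
    forall v, z + b <= v -> - z - b <= v -> z - b <= v /\ - z + b <= v.
  move=> Sa; apply: disjointvI; first exact: main.
  have := main (- a); rewrite opprK; apply=> s /Sa; exact: disjointvNr.
move=> Sb v v1 v2.
have bound s : S s -> s - b <= v + (z - s) /\ - s + b <= v + (z - s).
  move=> Ss; apply/(disjointvP s b).1; first exact: Sb.
  have sz := zub _ Ss; split.
    rewrite -[s + b]addr0; apply: lev_D; last by rewrite (@subv_ge0 R).
    by apply: le_trans v1; rewrite lev_D2r.
  have -> : - s - b = (- z - b) + (z - s).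
    by rewrite [RHS]addrC addrACA subrr add0r.
  exact: lev_D.
split.
    have [h hE] := half_ex (v + z + b).
  have zh : z <= h.
    apply: zlb => s Ss; have [+ _] := bound s Ss.
    by rewrite lev_subl addrA (addrAC _ _ b) lev_subr -(lev_double s) hE.
  by have := lev_D zh zh; rewrite hE lev_subl addrAC lev_D2r.
(* The second inequality of [bound] has [- s] on both sides, so one element of [S] suffices; this is
   where [S] must be nonempty. *)
have [s Ss] := S0; have [_] := bound s Ss.
by rewrite addrA [- s + b]addrC lev_D2r => h; rewrite addrC lev_subl.
Qed.

(** * Pairs with infimum 0, and disjointness in vector lattices *)

Definition meet0 p q : Prop := forall w, w <= p -> w <= q -> w <= 0.

Lemma meet0C p q : meet0 p q -> meet0 q p.
Proof. by move=> h w wq wp; apply: h. Qed.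

Lemma meet0_le p q r : r <= p -> meet0 p q -> meet0 r q.
Proof. by move=> rp h w wr; apply: h; apply: le_trans rp. Qed.

(** Half of [p + q - u] lies below both [p] and [q], hence below 0. For nonnegative [p] and [q] this
    makes [p + q] the absolute value of [p - q]. *)
Lemma meet0_add_le p q u : meet0 p q -> p - q <= u -> q - p <= u -> p + q <= u.
Proof.
move=> pq u1 u2; have [h hE] := half_ex (p + q - u).
have : h <= 0.
  apply: pq; rewrite -lev_double hE lev_subl.
    by rewrite -addrA lev_D2l addrC -lev_subl.
  by rewrite [p + q]addrC -addrA lev_D2l addrC -lev_subl.
by rewrite -lev_double hE addr0 lev_subl add0r.
Qed.

Lemma meet0_addl p q r : vector_lattice X -> 0 <= p -> 0 <= q -> 0 <= r ->
  meet0 p q -> meet0 r q -> meet0 (p + r) q.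
Proof.
move=> XL p0 q0 r0 pq rq w wpr wq.
(* The supremum [m] of [w - r] and 0 lies below [p] and [q]; hence [m <= 0], which gives
   [w <= r]. *)
have [[m [/ubound2E[wm m0] mlb]] _] := XL (w - r) 0.
have mle0 : m <= 0.
  apply: pq; apply: mlb; apply/ubound2E; split=> //; rewrite lev_subl//.
  by rewrite -[w]addr0; apply: lev_D.
apply: rq => //; move: (le_trans wm mle0).
by rewrite lev_subl add0r.
Qed.

Lemma meet0_addr p q r : vector_lattice X -> 0 <= p -> 0 <= q -> 0 <= r ->
  meet0 p q -> meet0 p r -> meet0 p (q + r).
Proof.
move=> XL p0 q0 r0 pq pr; apply: meet0C.
by apply: meet0_addl => //; exact: meet0C.
Qed.

Lemma pos_neg_parts x : vector_lattice X ->
  exists p q, [/\ 0 <= p, 0 <= q, x = p - q & meet0 p q].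
Proof.
move=> XL; have [[p [/ubound2E[xp p0] plb]] _] := XL x 0.
exists p, (p - x); split=> //; first by rewrite subv_ge0.
  by rewrite opprB addrC subrK.
(* [p - w] is an upper bound of [x] and 0, hence at least their supremum [p]. *)
move=> w wp wpx; rewrite -(lev_D2r (p - w)) add0r addrC subrK.
apply: plb; apply/ubound2E; rewrite subv_ge0; split=> //.
by rewrite lev_subr addrC -lev_subr.
Qed.

Lemma lev_BD x y : 0 <= y -> x - y <= x + y.
Proof.
by move=> y0; rewrite lev_D2l; apply: le_trans (y0); rewrite -oppr0 lev_N2.
Qed.

(** Only the pair [p], [b] is treated: changing the sign of [p - q] or of [b - c] yields the other
    three pairs. *)
Lemma disjointv_meet0 p q b c : 0 <= p -> 0 <= q -> 0 <= b -> 0 <= c ->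
  meet0 p q -> meet0 b c -> disjointv (p - q) (b - c) -> meet0 p b.
Proof.
move=> p0 q0 b0 c0 pq bc /disjointvP xa w wp wb.
(* Since [w] is below [p] and [b], the first two terms bound the absolute value of [p - b], and
   [q + c] bounds that of [q - c]. So [u] dominates the difference of the two elements up to
   sign. *)
set u := (p - w) + (b - w) + (q + c).
have pw : 0 <= p - w by rewrite subv_ge0.
have bw : 0 <= b - w by rewrite subv_ge0.
have BB v v' : v - v' = (v - w) - (v' - w) by rewrite opprB addrA subrK.
have [u1 u2] : p - q - (b - c) <= u /\ - (p - q) + (b - c) <= u.
  rewrite !opprB; split.
    rewrite addrACA -opprD [q + b]addrC opprD addrACA BB.
    by apply: lev_D; rewrite ?[q + c]addrC; exact: lev_BD.
  rewrite addrC addrACA -opprD [c + p]addrC opprD addrACA BB /u.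
  by rewrite [p - w + _]addrC; apply: lev_D; exact: lev_BD.
have [u3 u4] : p - q + (b - c) <= u /\ - (p - q) - (b - c) <= u.
  by apply/xa.
(* By disjointness [u] bounds all four sign combinations of [p - q] and [b - c], hence the sum of
   the two absolute values. Cancelling leaves [w + w <= 0]. *)
have : p + q + (b + c) <= u.
  rewrite -lev_subr; apply: meet0_add_le => //.
    rewrite lev_subr addrC -lev_subr; apply: meet0_add_le => //.
      by rewrite lev_subr [b - c + _]addrC.
    by rewrite lev_subr -[c - b]opprB [- _ + _]addrC.
  rewrite lev_subr addrC -lev_subr; apply: meet0_add_le => //.
    by rewrite lev_subr -[q - p]opprB [b - c + _]addrC.
  by rewrite lev_subr -[q - p]opprB -[c - b]opprB [- _ + _]addrC.
rewrite addrACA lev_D2r addrACA -opprD lev_subr -[leRHS]addr0 lev_D2l.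
by rewrite -[leRHS]addr0 lev_double.
Qed.

(** The sum of the two elements is [(p + b) - (q + c)], whose terms have infimum 0, so an upper
    bound of it and its negative bounds [p + b + q + c], which dominates the difference up to sign.
    Exchanging [b] and [c] gives the other inclusion. *)
Lemma meet0_disjointv p q b c : vector_lattice X ->
  0 <= p -> 0 <= q -> 0 <= b -> 0 <= c -> meet0 p q -> meet0 b c ->
  meet0 p b -> meet0 p c -> meet0 q b -> meet0 q c ->
  disjointv (p - q) (b - c).
Proof.
move=> XL p0 q0 b0 c0 pq bc pb pc qb qc.
suff main b' c' : 0 <= b' -> 0 <= c' -> meet0 b' c' ->
    meet0 p b' -> meet0 p c' -> meet0 q b' -> meet0 q c' ->
    forall u, p - q + (b' - c') <= u -> - (p - q) - (b' - c') <= u ->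
      p - q - (b' - c') <= u /\ - (p - q) + (b' - c') <= u.
  apply: disjointvI; first exact: main.
  by move=> u; rewrite -!(opprB c b) opprK; apply: main => //; exact: meet0C.
move=> {b c b0 c0 bc pb pc qb qc} b0 c0 bc pb pc qb qc u.
move: b' c' b0 c0 bc pb pc qb qc => b c b0 c0 bc pb pc qb qc.
rewrite -opprD addrACA -opprD opprB => u1 u2.
have le_u : p + b + (q + c) <= u.
  have bq := meet0C qb; apply: meet0_add_le => //.
  by apply: meet0_addl => //; [exact: addv_ge0 | exact: meet0_addr..].
rewrite !opprB; split; apply: le_trans le_u.
  have -> : p + b + (q + c) = p + c + (q + b).
    by rewrite addrACA [b + c]addrC addrACA.
  by rewrite addrACA -opprD; apply/lev_BD/addv_ge0.
have -> : p + b + (q + c) = q + b + (p + c).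
  by rewrite [LHS]addrC addrACA [c + b]addrC addrACA.
by rewrite addrACA -opprD; apply/lev_BD/addv_ge0.
Qed.

(** The absolute value [p + q] of [y] bounds [y] and [- y], hence [x] and [- x], so it dominates
    both parts of [x]. It has infimum 0 with each part of [a], and therefore so do the parts of
    [x]. *)
Lemma disjointv_solid x y a : vector_lattice X -> disjointv y a ->
  ubound [set y; - y] `<=` ubound [set x; - x] -> disjointv x a.
Proof.
move=> XL ya yx.
have [p [q [p0 q0 yE pq]]] := pos_neg_parts y XL.
have [r [s [r0 s0 xE rs]]] := pos_neg_parts x XL.
have [b [c [b0 c0 aE bc]]] := pos_neg_parts a XL.
have : r + s <= p + q.
  have /yx/ubound2E[] : ubound [set y; - y] (p + q).
    apply/ubound2E; rewrite yE opprB; split.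
      exact: lev_BD.
    by rewrite [p + q]addrC; exact: lev_BD.
  by rewrite xE opprB => h1 h2; apply: meet0_add_le.
move=> rspq.
have rpq : r <= p + q.
  by apply: le_trans rspq; rewrite -[leLHS]addr0 lev_D2l.
have spq : s <= p + q.
  by apply: le_trans rspq; rewrite -[leLHS]add0r lev_D2r.
have qp := meet0C pq; have cb := meet0C bc.
have pqb : meet0 (p + q) b.
  apply: meet0_addl => //.
    by apply: (@disjointv_meet0 p q b c) => //; rewrite -yE -aE.
  apply: (@disjointv_meet0 q p b c) => //; rewrite -opprB -yE -aE.
  exact: disjointvNl.
have pqc : meet0 (p + q) c.
  apply: meet0_addl => //.
    apply: (@disjointv_meet0 p q c b) => //; rewrite -yE -opprB -aE.
    exact: disjointvNr.
  apply: (@disjointv_meet0 q p c b) => //; rewrite -opprB -yE -opprB -aE.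
  exact/disjointvNl/disjointvNr.
by rewrite xE aE; apply: meet0_disjointv => //; apply: meet0_le; eassumption.
Qed.

End OrderedVectorTheory.

(** * Transfer of upper bounds and disjointness to the vector lattice cover *)

Section OrderDenseEmbedding.
Context {R : realType} {X Y : orderedVectType R} (i : {linear X -> Y}).
Hypotheses (i_bipos : bipositive i) (i_dense : order_dense (range i)).

Lemma bipositive_le x y : (i x <= i y) = (x <= y).
Proof.
rewrite -(@subv_ge0 R _ (i x)) -(@subv_ge0 R _ x) -raddfB.
by apply/idP/idP => /i_bipos.
Qed.

(** By order density an upper bound [u] in [Y] is the infimum of the elements of the range above it,
    and those come from upper bounds in [X]. *)
Lemma ubound_sub_image (A C : set X) :
  ubound A `<=` ubound C <-> ubound (i @` A) `<=` ubound (i @` C).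
Proof.
split=> subAC u uA.
  move=> _ [c Cc <-]; have [_ glb] := i_dense.2 u; apply: glb.
  move=> _ [[v _ <-] uv]; rewrite bipositive_le; apply: subAC Cc => w Aw.
  by rewrite -bipositive_le; apply: le_trans uv; apply: uA; exists w.
move=> c Cc; rewrite -bipositive_le; apply: subAC; last by exists c.
by move=> _ [w Aw <-]; rewrite bipositive_le; apply: uA.
Qed.

Lemma ubound_eq_image (A C : set X) :
  ubound A = ubound C <-> ubound (i @` A) = ubound (i @` C).
Proof.
split=> eqAC; apply/seteqP; split.
- by apply/(ubound_sub_image A C).1; rewrite eqAC.
- by apply/(ubound_sub_image C A).1; rewrite eqAC.
- by apply/(ubound_sub_image A C).2; rewrite eqAC.
- by apply/(ubound_sub_image C A).2; rewrite eqAC.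
Qed.

Lemma disjointv_image x a : disjointv x a <-> disjointv (i x) (i a).
Proof.
rewrite /disjointv (ubound_eq_image [set x + a; - x - a]).
by rewrite !image_setU !image_set1 !(raddfD, raddfN).
Qed.

End OrderDenseEmbedding.

Lemma band_ideal (R : realType) (X : orderedVectType R) (B : set X) :
  pre_riesz X -> band B -> ideal B.
Proof.
move=> [Y [i [YL ibi idense]]] [linB BE]; split=> // x y.
(* Writing [B] as a disjoint complement reduces solidity to disjointness from one [a] at a time. *)
rewrite -{1 2}BE => By yx a Ba; apply/(disjointv_image ibi idense).
apply: (disjointv_solid YL (y := i y)).
  exact/(disjointv_image ibi idense)/By.
move/(ubound_sub_image ibi idense): yx.
by rewrite !image_setU !image_set1 !raddfN.
Qed.

Theorem corollary18 (R : realType) (X : orderedVectType R) (B : set X) :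
  archimedean X -> pre_riesz X -> riesz_decomposition X ->
  band B -> directed B -> s_closed B.
Proof.
move=> _ prX _ bandB _; split; first exact: band_ideal.
have [[B0 _] BE] := bandB; move=> z z0 supz; rewrite -BE => a Ba.
apply: disjointv_sup supz _.
  (* As [0 <= z], the element 0 of [B] lies in the interval, so the set is nonempty. *)
  exists 0; split; first by rewrite inE in B0.
  by rewrite /= in_itv /= lexx z0.
by move=> s []; rewrite -{1}BE => Bs _; apply: Bs.
Qed.
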